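(* Let $\Lambda$ and $\Gamma$ be finite graphs. If $\Lambda$ is isomorphic to an induced subgraph of the extension graph $\Gamma^e$, then $A(\Lambda)$ embeds into $A(\Gamma)$, i.e. there is an injective group homomorphism $A(\Lambda)\to A(\Gamma)$.
   Context: A graph is a (possibly infinite) simplicial 1-complex (no loops, no multi-edges). For a graph $\Gamma$ with vertex set $V(\Gamma)$ and edge set $E(\Gamma)$, the right-angled Artin group is $A(\Gamma)=\langle V(\Gamma)\mid [v,v']=1 \text{ for each } \{v,v'\}\in E(\Gamma)\rangle$. The extension graph $\Gamma^e$ is the graph whose vertices are the elements of $A(\Gamma)$ that are conjugate to vertices of $\Gamma$ (viewed as generators), two distinct vertices being adjacent if and only if they commute in $A(\Gamma)$. *)

(* Defs.v *)
From HB Require Import structures.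
From mathcomp Require Import all_boot.
From mathcomp Require Import boolp classical_sets functions cardinality.

Set Implicit Arguments.
Unset Strict Implicit.
Unset Printing Implicit Defensive.

Local Open Scope group_scope.
Local Open Scope quotient_scope.

(** A letter [(s, false)] stands for the generator [s], and [(s, true)] for its
    formal inverse. *)
Definition word (S : Type) := seq (S * bool).

Definition inv_letter (S : Type) (a : S * bool) : S * bool := (a.1, ~~ a.2).

Definition inv_word (S : Type) (w : word S) : word S :=
  rev [seq inv_letter a | a <- w].

(** The congruence on words whose quotient is the group < S | R >. *)
Inductive pres_rel (S : Type) (R : set (word S)) : word S -> word S -> Prop :=
| pres_refl w : pres_rel R w w
| pres_sym w1 w2 : pres_rel R w1 w2 -> pres_rel R w2 w1
| pres_trans w1 w2 w3 :
    pres_rel R w1 w2 -> pres_rel R w2 w3 -> pres_rel R w1 w3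
| pres_cat u1 u2 w1 w2 :
    pres_rel R u1 u2 -> pres_rel R w1 w2 -> pres_rel R (u1 ++ w1) (u2 ++ w2)
| pres_cancel a : pres_rel R [:: a; inv_letter a] [::]
| pres_relator r : R r -> pres_rel R r [::].

Section PresentedGroup.
Variables (S : choiceType) (R : set (word S)).

Definition pres_eqb : rel (word S) := fun w1 w2 => `[< pres_rel R w1 w2 >].

Lemma pres_eqb_refl : reflexive pres_eqb.
Proof. by move=> w; apply/asboolP/pres_refl. Qed.

Lemma pres_eqb_sym : symmetric pres_eqb.
Proof. by move=> w1 w2; apply/asboolP/asboolP; apply: pres_sym. Qed.

Lemma pres_eqb_trans : transitive pres_eqb.
Proof.
by move=> w2 w1 w3 /asboolP h12 /asboolP h23; apply/asboolP/(pres_trans h12).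
Qed.

Canonical pres_equiv := EquivRel pres_eqb pres_eqb_refl pres_eqb_sym pres_eqb_trans.

Definition presented : Type := {eq_quot pres_equiv}.

HB.instance Definition _ := Choice.on presented.
HB.instance Definition _ := EqQuotient.on presented.

Lemma pres_piP (w1 w2 : word S) :
  (\pi_presented w1 = \pi_presented w2) <-> pres_rel R w1 w2.
Proof. by split=> [/eqquotP/asboolP | h] //; apply/eqquotP/asboolP. Qed.

Definition pres_one : presented := \pi_presented [::].
Definition pres_mul (x y : presented) : presented :=
  \pi_presented (repr x ++ repr y).
Definition pres_inv (x : presented) : presented :=
  \pi_presented (inv_word (repr x)).

Lemma inv_letterK : involutive (@inv_letter S).
Proof. by case=> s b; rewrite /inv_letter /= negbK. Qed.

Lemma inv_wordK : involutive (@inv_word S).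
Proof.
move=> w; rewrite /inv_word map_rev revK -map_comp -[RHS]map_id.
by apply: eq_map => a /=; rewrite inv_letterK.
Qed.

Lemma inv_word_cons a (w : word S) :
  inv_word (a :: w) = inv_word w ++ [:: inv_letter a].
Proof. by rewrite /inv_word /= rev_cons cats1. Qed.

Lemma pres_repr_pi w : pres_rel R (repr (\pi_presented w)) w.
Proof. by apply/pres_piP; rewrite reprK. Qed.

Lemma pres_catV w : pres_rel R (w ++ inv_word w) [::].
Proof.
elim: w => [|a w IHw]; first exact: pres_refl.
rewrite inv_word_cons -[a :: w]cat1s -catA (catA w).
apply: pres_trans (pres_cancel R a); rewrite -[[:: a; _]]cat1s.
apply: pres_cat; first exact: pres_refl.
exact: (pres_cat IHw (pres_refl R [:: inv_letter a])).
Qed.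

Lemma pres_Vcat w : pres_rel R (inv_word w ++ w) [::].
Proof. by rewrite -{2}[w]inv_wordK; apply: pres_catV. Qed.

Lemma pi_mul u w : pres_mul (\pi_presented u) (\pi_presented w) = \pi_presented (u ++ w).
Proof. by apply/(pres_piP (_ ++ _))/pres_cat; apply: pres_repr_pi. Qed.

Lemma pres_mulA : associative pres_mul.
Proof.
elim/quotW=> u; elim/quotW=> v; elim/quotW=> w.
by rewrite (pi_mul v w) (pi_mul u v) (pi_mul u (v ++ w)) (pi_mul (u ++ v) w) catA.
Qed.

Lemma pres_mul1 : left_id pres_one pres_mul.
Proof. by elim/quotW=> w; apply: (pi_mul [::] w). Qed.

Lemma pres_mulr1 : right_id pres_one pres_mul.
Proof. by elim/quotW=> w; rewrite -[in RHS](cats0 w); apply: (pi_mul w [::]). Qed.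

Lemma pres_mulV : left_inverse pres_one pres_inv pres_mul.
Proof.
move=> x; rewrite -{2}[x]reprK.
by apply: etrans (pi_mul (inv_word (repr x)) (repr x)) _; apply/pres_piP/pres_Vcat.
Qed.

Lemma pres_mulrV : right_inverse pres_one pres_inv pres_mul.
Proof.
move=> x; rewrite -{1}[x]reprK.
by apply: etrans (pi_mul (repr x) (inv_word (repr x))) _; apply/pres_piP/pres_catV.
Qed.

HB.instance Definition _ := isGroup.Build presented
  pres_mulA pres_mul1 pres_mulr1 pres_mulV pres_mulrV.

Definition pres_gen (s : S) : presented := \pi_presented [:: (s, false)].

End PresentedGroup.

(** Graphs may be infinite, and have neither loops nor multiple edges. *)
Record graph := Graph {
  vertex :> choiceType;
  adj : rel vertex;
  adj_sym : symmetric adj;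
  adj_irrefl : irreflexive adj
}.

Definition finite_graph (Gamma : graph) : Prop := finite_set [set: Gamma].

Definition graph_iso (Gamma Delta : graph) : Prop :=
  exists2 f : Gamma -> Delta,
    bijective f & forall u v, adj (f u) (f v) = adj u v.

Section InducedSubgraph.
Variables (Gamma : graph) (A : {pred Gamma}).

Definition induced_vertex : choiceType := {x : Gamma | x \in A}.

Definition induced_adj : rel induced_vertex := fun x y => adj (val x) (val y).

Lemma induced_adj_sym : symmetric induced_adj.
Proof. by move=> x y; apply: adj_sym. Qed.

Lemma induced_adj_irrefl : irreflexive induced_adj.
Proof. by move=> x; apply: adj_irrefl. Qed.

Definition induced_subgraph : graph := Graph induced_adj_sym induced_adj_irrefl.

End InducedSubgraph.

(** The relators v^-1 w^-1 v w of the right-angled Artin group of [Gamma]. *)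
Definition raag_relators (Gamma : graph) : set (word Gamma) :=
  [set r | exists v w : Gamma, adj v w /\
     r = [:: (v, true); (w, true); (v, false); (w, false)]].

Definition raag (Gamma : graph) : groupType :=
  presented (@raag_relators Gamma).

Definition raag_gen (Gamma : graph) (v : Gamma) : raag Gamma :=
  pres_gen (@raag_relators Gamma) v.

Section ExtensionGraph.
Variable Gamma : graph.

Definition conj_vertex : {pred raag Gamma} :=
  fun x => `[< exists (v : Gamma) (g : raag Gamma), x = raag_gen v ^ g >].

Definition ext_vertex : choiceType := {x : raag Gamma | x \in conj_vertex}.

Definition ext_adj : rel ext_vertex :=
  fun x y => (x != y) && (val x * val y == val y * val x).

Lemma ext_adj_sym : symmetric ext_adj.
Proof. by move=> x y; rewrite /ext_adj eq_sym; congr (_ && _); rewrite eq_sym. Qed.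

Lemma ext_adj_irrefl : irreflexive ext_adj.
Proof. by move=> x; rewrite /ext_adj eqxx. Qed.

Definition extension_graph : graph := Graph ext_adj_sym ext_adj_irrefl.

End ExtensionGraph.

(* Main.v *)
Require Import Defs.
From HB Require Import structures.
From mathcomp Require Import all_boot perm.
From mathcomp Require Import boolp classical_sets functions cardinality.
From mathcomp Require Import zify.

(** Write the vertices of [Lambda] as conjugates [x_a = g_a c_a g_a^-1] of
    generators of [A(Gamma)] and induct on the total length of the words [g_a].
    If all of them are empty, then [Lambda] is an induced subgraph of [Gamma] and
    [A(Lambda)] is a retract of [A(Gamma)].  Otherwise let [v] be a letter of some
    [g_a], and glue [n] copies of [Gamma] along the star of [v].  Sending [v] to
    [v^n] and the [i]-th copy of [u] to [v^i u v^-i] embeds the right-angled Artin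
    group of the resulting graph into [A(Gamma)], as one sees by letting
    [A(Gamma)] act on [n] copies of that group.  For [n = 2m + 1] with [m] large,
    each [v^m x_a v^-m], or its [n]-th power if [c_a = v], is the image of a
    conjugate of a generator by [g_a] with its letters [v] deleted.  Passing to
    powers changes neither distinctness nor commutation, because the powers of a
    generator have the same centralizer as the generator itself. *)

Set Implicit Arguments.
Unset Strict Implicit.
Unset Printing Implicit Defensive.

Local Open Scope group_scope.
Local Open Scope quotient_scope.

(** * Right actions of [A(Gamma)] defined on letters *)

Section WordAction.
Variables (Gamma : graph) (X : Type) (a : Gamma * bool -> X -> X).
Hypothesis aK : forall l p, a (inv_letter l) (a l p) = p.
Hypothesis aC : forall u w p, adj u w ->
  a (w, false) (a (u, false) p) = a (u, false) (a (w, false) p).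

Definition word_act (w : word Gamma) (p : X) : X := foldl (fun q l => a l q) p w.

Lemma word_act_rel w1 w2 : pres_rel (@raag_relators Gamma) w1 w2 ->
  word_act w1 =1 word_act w2.
Proof.
elim=> {w1 w2} [//|w1 w2 _ IH p|w1 w2 w3 _ IH1 _ IH2 p|u1 u2 w1 w2 _ IH1 _ IH2 p
  |l p|r [u [w [uw ->]]] p].
- by rewrite IH.
- by rewrite IH1.
- by rewrite /word_act !foldl_cat -!/(word_act _ _) IH1 IH2.
- exact: aK.
- by rewrite /= aC // (aK (w, true)) (aK (u, true)).
Qed.

Definition raag_act (x : raag Gamma) (p : X) : X := word_act (repr x) p.

Lemma raag_act_pi w p : raag_act (\pi w) p = word_act w p.
Proof. by apply: word_act_rel; apply: pres_repr_pi. Qed.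

Lemma raag_act1 p : raag_act 1 p = p.
Proof. exact: (raag_act_pi [::]). Qed.

Lemma raag_actM x y p : raag_act (x * y) p = raag_act y (raag_act x p).
Proof. by rewrite [LHS]raag_act_pi /word_act foldl_cat. Qed.

Lemma raag_act_gen v p : raag_act (raag_gen v) p = a (v, false) p.
Proof. exact: raag_act_pi. Qed.

Lemma raag_actK x p : raag_act x^-1 (raag_act x p) = p.
Proof. by rewrite -raag_actM mulgV raag_act1. Qed.

End WordAction.

(** * Words and the elements they represent *)

Section Words.
Variable Gamma : graph.

Definition letter_elt (l : Gamma * bool) : raag Gamma :=
  if l.2 then (raag_gen l.1)^-1 else raag_gen l.1.

Definition word_elt (w : word Gamma) : raag Gamma := \pi w.

Lemma word_elt_nil : word_elt [::] = 1.
Proof. by []. Qed.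

Lemma word_elt_cat w1 w2 : word_elt (w1 ++ w2) = word_elt w1 * word_elt w2.
Proof. by symmetry; apply: pi_mul. Qed.

Lemma word_elt_cons l w : word_elt (l :: w) = letter_elt l * word_elt w.
Proof.
rewrite -cat1s word_elt_cat; congr (_ * _).
case: l => s [] //; rewrite /letter_elt /=; symmetry; apply: mulg1_eq.
by rewrite -[raag_gen s]/(word_elt [:: (s, false)]) -word_elt_cat;
  apply/pres_piP/pres_cancel.
Qed.

Lemma word_elt_repr (x : raag Gamma) : word_elt (repr x) = x.
Proof. exact: reprK. Qed.

Lemma raag_ind (P : raag Gamma -> Prop) : P 1 ->
  (forall l x, P x -> P (letter_elt l * x)) -> forall x, P x.
Proof.
move=> P1 PM x; rewrite -[x]word_elt_repr.
by elim: (repr x) => [//|l w IH]; rewrite word_elt_cons; apply: PM.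
Qed.

Lemma raag_gen_commute (u w : Gamma) : adj u w ->
  commute (raag_gen u) (raag_gen w).
Proof.
move=> uw; have : word_elt [:: (u, true); (w, true); (u, false); (w, false)] = 1.
  by apply/pres_piP/pres_relator; exists u, w.
rewrite !word_elt_cons word_elt_nil mulg1 /letter_elt /= => e.
by apply/commgP/eqP; rewrite /commg /conjg.
Qed.

End Words.

(** * Universal property of [A(Gamma)] *)

Section Lift.
Variables (Gamma : graph) (H : groupType) (f : Gamma -> H).
Hypothesis fC : forall u w, adj u w -> commute (f u) (f w).

(** Letters act on [H] by right multiplication; the orbit map of [1] is the wanted homomorphism,
    since right multiplications commute with left ones. *)
Let letter_mul (l : Gamma * bool) (h : H) : H :=
  h * (if l.2 then (f l.1)^-1 else f l.1).

Let letter_mulK l h : letter_mul (inv_letter l) (letter_mul l h) = h.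
Proof. by case: l => s [] /=; rewrite /letter_mul /= ?mulgK ?mulgVK. Qed.

Let letter_mulC u w h : adj u w ->
  letter_mul (w, false) (letter_mul (u, false) h) =
  letter_mul (u, false) (letter_mul (w, false) h).
Proof. by move=> /fC uw; rewrite /letter_mul /= -!mulgA uw. Qed.

Let lift (x : raag Gamma) : H := raag_act letter_mul x 1.

Let lift_mull x h : raag_act letter_mul x h = h * lift x.
Proof.
rewrite /lift /raag_act; elim: (repr x) h => [|l w IH] h /=.
  by rewrite mulg1.
by rewrite IH [in RHS]IH /letter_mul mul1g mulgA.
Qed.

Let lift1 : lift 1 = 1.
Proof. exact: raag_act1. Qed.

Let liftM : {morph lift : x y / x * y}.
Proof.
by move=> x y; rewrite {1}/lift (raag_actM letter_mulK letter_mulC) lift_mull.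
Qed.

HB.instance Definition _ := isUMagmaMorphism.Build _ _ lift (lift1, liftM).

Lemma raag_lift :
  exists F : UMagmaMorphism.type (raag Gamma) H, forall v, F (raag_gen v) = f v.
Proof.
exists lift => v.
by rewrite /= /lift (raag_act_gen letter_mulK letter_mulC) /letter_mul mul1g.
Qed.

End Lift.

Lemma gmulf_letter (Gamma : graph) (H : groupType)
    (F : UMagmaMorphism.type (raag Gamma) H) l :
  F (letter_elt l) = if l.2 then (F (raag_gen l.1))^-1 else F (raag_gen l.1).
Proof. by case: l => s []; rewrite /letter_elt // gmulfV. Qed.

(** * Telling generators apart in finite permutation groups *)

(** Counting occurrences of [v] modulo 2 respects every commutation relation. *)
Lemma raag_gen_parity (Gamma : graph) (v : Gamma) :
  exists (F : UMagmaMorphism.type (raag Gamma) {perm bool}) (t : {perm bool}),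
    [/\ t != 1, t ^+ 2 = 1 & forall u, F (raag_gen u) = if u == v then t else 1].
Proof.
have [|F FE] := @raag_lift Gamma {perm bool}
    (fun u => if u == v then tperm false true else 1).
  by move=> u w _; case: (u == v); case: (w == v);
    rewrite /commute ?mulg1 ?mul1g.
exists F, (tperm false true); split => //; last by rewrite expg2 tperm2.
by apply/eqP => /permP/(_ false); rewrite tpermL perm1.
Qed.

(* Non-adjacent generators are separated by two transpositions of three points. *)
Lemma raag_gen_commute_adj (Gamma : graph) (v w : Gamma) : v != w ->
  commute (raag_gen v) (raag_gen w) -> adj v w.
Proof.
move=> vw cvw; apply: contraT => /negbTE nvw.
pose a : 'I_3 := inord 0; pose b : 'I_3 := inord 1; pose c : 'I_3 := inord 2.
have [|F FE] := @raag_lift Gamma {perm 'I_3}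
    (fun u => if u == v then tperm a b else if u == w then tperm b c else 1).
  move=> x y xy; case: (x =P v) => [xv|_]; case: (y =P v) => [yv|_] //.
  - case: (y =P w) => [yw|_]; last by rewrite /commute mulg1 mul1g.
    by rewrite xv yw nvw in xy.
  - case: (x =P w) => [xw|_]; last by rewrite /commute mulg1 mul1g.
    by rewrite adj_sym xw yv nvw in xy.
  - by case: (x == w); case: (y == w); rewrite /commute ?mulg1 ?mul1g.
have := gmulf_commute F cvw; rewrite !FE !eqxx eq_sym (negbTE vw).
(* The two products of the transpositions send [a] to [c] and to [b] respectively. *)
move=> /permP/(_ a); rewrite !permM tpermL tpermL.
have ab : a != b by apply/eqP => /(congr1 val); rewrite /= !inordK.
have ac : a != c by apply/eqP => /(congr1 val); rewrite /= !inordK.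
have bc : b != c by apply/eqP => /(congr1 val); rewrite /= !inordK.
rewrite (@tpermD _ b c a) ?tpermL; last 2 first.
- by rewrite eq_sym.
- by rewrite eq_sym.
by move/eqP; rewrite eq_sym (negbTE bc).
Qed.

(** * Skew actions with a cyclic index *)

(* [A(Gamma)] acts on the right of [G * 'I_n]: the generators other than [v] keep
   the index, and [v] shifts it cyclically. *)
Section SkewAction.
Variables (Gamma : graph) (v : Gamma) (G : groupType) (n : nat).
Variable k : Gamma -> 'I_n -> G.
Hypothesis kC : forall u w i, u != v -> w != v -> adj u w ->
  commute (k u i) (k w i).
Hypothesis kvC : forall u i, adj v u -> k v i * k u (ordS i) = k u i * k v i.

(** [k u i] is the factor collected when [u] is read at index [i]. Reading the inverse of [v] undoes
    a step that began at the preceding index, hence [ord_pred] inside [k]. *)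
Definition skew_letter (l : Gamma * bool) (p : G * 'I_n) : G * 'I_n :=
  if l.1 == v then
    if l.2 then (p.1 * (k v (ord_pred p.2))^-1, ord_pred p.2)
    else (p.1 * k v p.2, ordS p.2)
  else (p.1 * (if l.2 then (k l.1 p.2)^-1 else k l.1 p.2), p.2).

Let skewK l p : skew_letter (inv_letter l) (skew_letter l p) = p.
Proof.
case: l p => s [] [g i]; rewrite /skew_letter /=; case: (s == v) => /=.
all: by rewrite ?(ord_predK, ordSK) ?(mulgK, mulgVK).
Qed.

Let skewC u w p : adj u w ->
  skew_letter (w, false) (skew_letter (u, false) p) =
  skew_letter (u, false) (skew_letter (w, false) p).
Proof.
case: p => g i uw; rewrite /skew_letter /=.
case: (eqVneq u v) => [uv|uv]; case: (eqVneq w v) => [wv|wv] //=.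
- by rewrite uv in uw *; rewrite -!mulgA kvC.
- by rewrite adj_sym wv in uw *; rewrite -!mulgA kvC.
- by rewrite -!mulgA kC.
Qed.

Definition skew (x : raag Gamma) := raag_act skew_letter x.

Lemma skewM x y p : skew (x * y) p = skew y (skew x p).
Proof. exact: raag_actM. Qed.

Lemma skew1 p : skew 1 p = p.
Proof. exact: raag_act1. Qed.

Lemma skewKE x p q : skew x p = q -> skew x^-1 q = p.
Proof. by move=> <-; apply: raag_actK. Qed.

Lemma skew_gen u g i : u != v -> skew (raag_gen u) (g, i) = (g * k u i, i).
Proof.
by move=> uv; rewrite [LHS](raag_act_gen skewK skewC) /skew_letter (negbTE uv).
Qed.

Lemma skew_base g i : skew (raag_gen v) (g, i) = (g * k v i, ordS i).
Proof.
by rewrite [LHS](raag_act_gen skewK skewC) /skew_letter eqxx.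
Qed.

Lemma skew_genV u g i :
  u != v -> skew (raag_gen u)^-1 (g, i) = (g * (k u i)^-1, i).
Proof. by move=> uv; apply: skewKE; rewrite skew_gen // mulgVK. Qed.

Lemma skew_baseV g i :
  skew (raag_gen v)^-1 (g, i) = (g * (k v (ord_pred i))^-1, ord_pred i).
Proof. by apply: skewKE; rewrite skew_base mulgVK ord_predK. Qed.

End SkewAction.

Lemma skew_letter_elt (Gamma : graph) (v : Gamma) (G : groupType) (n : nat)
    (k : Gamma -> 'I_n -> G)
    (kC : forall u w i, u != v -> w != v -> adj u w -> commute (k u i) (k w i))
    (kvC : forall u i, adj v u -> k v i * k u (ordS i) = k u i * k v i) u b g i :
  u != v ->
  skew v k (letter_elt (u, b)) (g, i) = (g * (if b then (k u i)^-1 else k u i), i).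
Proof.
move=> uv; rewrite /letter_elt; case: b => /=.
  exact: (skew_genV kC kvC).
exact: (skew_gen kC kvC).
Qed.

Lemma val_ordS n (i : 'I_n) : i.+1 < n -> ordS i = i.+1 :> nat.
Proof. by move=> lt_in; rewrite /= modn_small. Qed.

Lemma val_ord_pred n (i : 'I_n) : 0 < i -> ord_pred i = i.-1 :> nat.
Proof.
case: i => [[//|i] lt_in] _ /=.
by rewrite modnDr modn_small // ltnW.
Qed.

Lemma commuteJ (G : groupType) (x y z : G) :
  commute x y -> commute (x ^ z) (y ^ z).
Proof. by move=> xy; rewrite /commute -!conjMg xy. Qed.

Lemma conjg_id (G : groupType) (x z : G) : commute x z -> x ^ z = x.
Proof. by move=> xz; rewrite conjgE xz mulKg. Qed.

Lemma conjg_signed (G : groupType) (z : G) (b : bool) (x : G) :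
  (if b then (x ^ z)^-1 else x ^ z) = (if b then x^-1 else x) ^ z.
Proof. by case: b; rewrite ?conjVg. Qed.

Lemma linkJ (Gamma : graph) (u v : Gamma) i : adj v u ->
  raag_gen u ^ (raag_gen v ^- i) = raag_gen u.
Proof.
move=> vu; apply: conjg_id; apply: commuteV; apply: commuteX.
by apply: commute_sym; apply: raag_gen_commute.
Qed.

(** * Centralizers of powers of a generator *)

Section Centralizer.
Variables (Gamma : graph) (v : Gamma) (m n : nat).

Let V := raag_gen v.

(* Outside the window [0, 2m], this action only sees the letters in the link of
   [v].  If [w] commutes with [v^l], then reading [w] from inside and from outside
   the window gives the same result, so [w] is a word in the link times a power
   of [v]. *)
Let k (u : Gamma) (i : 'I_n) : raag Gamma :=
  if u == v then 1 else
  if adj v u then raag_gen u else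
  if i <= m.*2 then raag_gen u ^ (V ^- i) else 1.

Let kC u w i : u != v -> w != v -> adj u w -> commute (k u i) (k w i).
Proof.
move=> uv wv /raag_gen_commute uw; rewrite /k (negbTE uv) (negbTE wv).
have uwJ := commuteJ (V ^- i) uw.
case vu: (adj v u); case vw: (adj v w); case: (i <= m.*2) => //.
- by rewrite -(linkJ i vu); exact: uwJ.
- exact: commute1.
- by rewrite -(linkJ i vw); exact: uwJ.
- exact/commute_sym/commute1.
Qed.

Let kvC u i : adj v u -> k v i * k u (ordS i) = k u i * k v i.
Proof.
move=> vu; rewrite /k eqxx vu mul1g mulg1.
by case: eqP => // uv; rewrite uv adj_irrefl in vu.
Qed.

Let skM := skewM kC kvC.

Let skew_pow g i l : exists j, skew v k (V ^+ l) (g, i) = (g, j) /\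
  (i + l < n -> j = i + l :> nat).
Proof.
elim: l i => [|l IH] i; first by exists i; rewrite (skew1 kC kvC) addn0.
rewrite expgS skM (skew_base kC kvC) {2}/k eqxx mulg1.
have [j [-> jE]] := IH (ordS i); exists j; split=> // lt_n.
have iE : ordS i = i.+1 :> nat by apply: val_ordS; lia.
by rewrite jE iE; lia.
Qed.

(** The index tracks the exponent of [V]: a letter [s] read at [i] contributes [V^i s V^-i], and the
    product telescopes. The bounds keep the index in the window. *)
Let skew_inside w g (i : 'I_n) : size w <= i -> i + size w <= m.*2 -> m.*2 < n ->
  exists j : 'I_n,
    skew v k (word_elt w) (g, i) = (g * (V ^+ i * word_elt w * V ^- j), j).
Proof.
elim: w g i => [|[s b] w IH] g i /= le_i le_m lt_n.
  by exists i; rewrite word_elt_nil (skew1 kC kvC) mulg1 mulgV mulg1.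
rewrite word_elt_cons skM; case: (eqVneq s v) => [->|sv]; last first.
  rewrite (skew_letter_elt kC kvC) //.
  have -> : k s i = raag_gen s ^ (V ^- i).
    rewrite /k (negbTE sv); case: ifP => [vs|_]; first by rewrite linkJ.
    by rewrite ifT //; lia.
  have [||//|j ->] := IH (g * (if b then (raag_gen s ^ (V ^- i))^-1
                             else raag_gen s ^ (V ^- i))) i; [lia|lia|].
  exists j; rewrite conjg_signed -/(letter_elt (s, b)) conjgE invgK.
  by rewrite !mulgA mulgVK.
case: b; rewrite /letter_elt /=.
  rewrite (skew_baseV kC kvC) {2}/k eqxx invg1 mulg1.
  have iE : ord_pred i = i.-1 :> nat by apply: val_ord_pred; lia.
  have [||//|j ->] := IH g (ord_pred i); [rewrite iE; lia|rewrite iE; lia|].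
  exists j; rewrite iE; have {2}-> : i = i.-1.+1 :> nat by lia.
  by rewrite expgSr !mulgA mulgK.
rewrite (skew_base kC kvC) {2}/k eqxx mulg1.
have iE : ordS i = i.+1 :> nat by apply: val_ordS; lia.
have [||//|j ->] := IH g (ordS i); [rewrite iE; lia|rewrite iE; lia|].
by exists j; rewrite iE expgSr !mulgA.
Qed.

(** Only letters in the link of [v] contribute here, and these commute with [V]. The bounds keep the
    index from reentering the window or wrapping around. *)
Let skew_outside w g (i : 'I_n) : m.*2 + size w < i -> i + size w < n ->
  exists (c : raag Gamma) (j : 'I_n),
    skew v k (word_elt w) (g, i) = (g * c, j) /\ commute V c.
Proof.
elim: w g i => [|[s b] w IH] g i /= lt_i lt_n.
  exists 1, i; rewrite word_elt_nil (skew1 kC kvC) mulg1; split => //.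
  exact: commute1.
rewrite word_elt_cons skM; case: (eqVneq s v) => [->|sv]; last first.
  rewrite (skew_letter_elt kC kvC) //.
  set x := if b then _ else _.
  have Vx : commute V x.
    have Vk : commute V (k s i).
      rewrite /k (negbTE sv); case: ifP => [vs|_].
        exact: raag_gen_commute.
      by rewrite ifF ?lia; [exact: commute1|lia].
    by rewrite /x; case: (b) => //; apply: commuteV.
  have [||c [j [-> Vc]]] := IH (g * x) i; [lia|lia|].
  by exists (x * c), j; rewrite mulgA; split => //; apply: commuteM.
case: b; rewrite /letter_elt /=.
  rewrite (skew_baseV kC kvC) {2}/k eqxx invg1 mulg1.
  have iE : ord_pred i = i.-1 :> nat by apply: val_ord_pred; lia.
  by apply: IH; rewrite iE; lia.
rewrite (skew_base kC kvC) {2}/k eqxx mulg1.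
have iE : ordS i = i.+1 :> nat by apply: val_ordS; lia.
by apply: IH; rewrite iE; lia.
Qed.

Lemma word_commute_pow w l : size w = m -> m.*2 < l -> l + m.*2 < n ->
  commute (word_elt w) (V ^+ l) -> commute (word_elt w) V.
Proof.
move=> sz lt_l lt_n cwl.
have lt_mn : m < n by lia.
(* The middle [m] of the window: a word of length [m] read from there stays in [[0, 2m]]. *)
pose i := Ordinal lt_mn.
have [|||j jE] := @skew_inside w 1 i; rewrite ?sz /=; try lia.
have [j' [j'E _]] := skew_pow (1 * (V ^+ i * word_elt w * V ^- j)) j l.
have [i' [i'E /(_ _) i'v]] := skew_pow 1 i l.
have {}i'v : i' = m + l :> nat by apply: i'v; rewrite /=; lia.
have [||c [j'' [cE Vc]]] := @skew_outside w 1 i'; rewrite ?sz ?i'v; try lia.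
(* Acting on [(1, i)] by the two equal products and comparing first components gives
   [V^i w V^-j = c]. *)
have := skM (word_elt w) (V ^+ l) (1, i).
rewrite cwl skM i'E cE jE j'E !mul1g => -[cE' _].
have -> : word_elt w = V ^- i * (c * V ^+ j) by rewrite cE' mulgVK mulKg.
apply: commute_sym; apply: commuteM; first by apply/commuteV/commuteX.
by apply: commuteM => //; apply/commuteX.
Qed.

End Centralizer.

(** * Powers of conjugates of generators *)

Lemma commute_gen_pow (Gamma : graph) (v : Gamma) (y : raag Gamma) l : 0 < l ->
  commute y (raag_gen v ^+ l) -> commute y (raag_gen v).
Proof.
move=> l0 yl; pose w := repr y; pose m := size w.
rewrite -[y]word_elt_repr -/w.
(* The exponent is replaced by its multiple [l * (2m + 1)], which exceeds [2m]; the number of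
   indices is then taken just large enough. *)
apply: (@word_commute_pow _ v m (l * m.*2.+1 + m.*2).+1 w (l * m.*2.+1)) => //.
  by rewrite -{1}(mul1n m.*2) (leq_trans _ (leq_mul l0 (leqnn _))) ?mul1n.
by rewrite expgnA word_elt_repr; apply: commuteX.
Qed.

Lemma commute_conj_pow (Gamma : graph) (v : Gamma) (y a : raag Gamma) l : 0 < l ->
  commute y ((raag_gen v ^ a) ^+ l) -> commute y (raag_gen v ^ a).
Proof.
move=> l0; rewrite -conjXg => /(commuteJ a^-1); rewrite conjgK.
by move=> /(commute_gen_pow l0)/(commuteJ a); rewrite conjgKV.
Qed.

Lemma commute_conj_pow2 (Gamma : graph) (u v : Gamma) (a b : raag Gamma) l m :
  0 < l -> 0 < m ->
  commute ((raag_gen u ^ a) ^+ l) ((raag_gen v ^ b) ^+ m) ->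
  commute (raag_gen u ^ a) (raag_gen v ^ b).
Proof.
move=> l0 m0 /(commute_conj_pow m0)/commute_sym/(commute_conj_pow l0).
exact: commute_sym.
Qed.

(** The element [b * a^-1] commutes with the [l]-th power of the generator, hence with the
    generator. *)
Lemma conj_pow_inj (Gamma : graph) (v : Gamma) (a b : raag Gamma) l : 0 < l ->
  (raag_gen v ^ a) ^+ l = (raag_gen v ^ b) ^+ l -> raag_gen v ^ a = raag_gen v ^ b.
Proof.
move=> l0; rewrite -!conjXg => /(congr1 (conjg^~ a^-1)); rewrite conjgK -conjgM.
move=> e; apply: (@conjg_inj _ a^-1); rewrite conjgK -conjgM; symmetry; apply: conjg_id.
apply: commute_sym; apply: (commute_gen_pow l0).
by rewrite /commute [RHS]conjgC -e.
Qed.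

(** Under the parity map of [u], the left side becomes a conjugate of the involution [t], while the
    right side becomes trivial if [v] differs from [u]. *)
Lemma conj_odd_pow_gen (Gamma : graph) (u v : Gamma) (a b : raag Gamma) l m :
  odd l -> odd m -> (raag_gen u ^ a) ^+ l = (raag_gen v ^ b) ^+ m -> u = v.
Proof.
move=> ol om; have [F [t [t1 t2 FE]]] := raag_gen_parity u.
move=> /(congr1 F); rewrite !gmulfXn !gmulfJ !FE eqxx.
case: eqP => [->//|_]; rewrite conj1g expg1n -conjXg => /eqP.
rewrite conjg_eq1 -(odd_double_half l) ol add1n expgS -mul2n expgnA t2 expg1n.
by rewrite mulg1 (negbTE t1).
Qed.

(** * Copies of [Gamma] glued along the star of [v] *)

Section StarCover.
Variables (Gamma : graph) (v : Gamma) (n : nat).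

Definition star : pred Gamma := fun u => (u == v) || adj v u.

(* A vertex of the star of [v] has a single copy, stored at index [0]. *)
Definition star_cover_pred : pred (Gamma * 'I_n.+1) :=
  fun p => star p.1 ==> (p.2 == ord0).

Definition star_cover_vertex : choiceType := {p | star_cover_pred p}.

(** A vertex of the star lies in all copies at once, so indices must agree only when both ends lie
    outside the star. *)
Definition star_cover_adj : rel star_cover_vertex := fun p q =>
  adj (val p).1 (val q).1 &&
  [|| (val p).2 == (val q).2, star (val p).1 | star (val q).1].

Lemma star_cover_adj_sym : symmetric star_cover_adj.
Proof.
by move=> p q; rewrite /star_cover_adj adj_sym eq_sym [star _ || _]orbC.
Qed.

Lemma star_cover_adj_irrefl : irreflexive star_cover_adj.
Proof. by move=> p; rewrite /star_cover_adj adj_irrefl. Qed.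

Definition star_cover : graph := Graph star_cover_adj_sym star_cover_adj_irrefl.

Fact star_cover_copy_subproof u (i : 'I_n.+1) :
  star_cover_pred (u, if star u then ord0 else i).
Proof. by rewrite /star_cover_pred /=; case: (star u). Qed.

Definition copy u i : star_cover :=
  exist (fun p => is_true (star_cover_pred p)) _ (star_cover_copy_subproof u i).

Lemma copy_val (p : star_cover) : copy (val p).1 (val p).2 = p.
Proof.
apply: val_inj; case: p => [[u i] /=]; rewrite /star_cover_pred /=.
by case: (star u) => //= /eqP->.
Qed.

Lemma adj_copy u w i : adj u w -> adj (copy u i) (copy w i).
Proof.
move=> uw; rewrite -[adj (copy u i) _]/(star_cover_adj _ _) /star_cover_adj /= uw.
by case: (star u); case: (star w); rewrite ?eqxx ?orbT.
Qed.

Lemma adj_copy_base u i j : adj v u -> adj (copy v i) (copy u j).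
Proof.
move=> vu; rewrite -[adj (copy v i) _]/(star_cover_adj _ _) /star_cover_adj /=.
by rewrite vu /star eqxx orbT.
Qed.

Let V := raag_gen v.

Lemma star_cover_hom :
  exists F : UMagmaMorphism.type (raag star_cover) (raag Gamma),
    (forall i, F (raag_gen (copy v i)) = V ^+ n.+1) /\
    (forall u i, u != v -> F (raag_gen (copy u i)) = raag_gen u ^ (V ^- i)).
Proof.
have [|F FE] := @raag_lift star_cover (raag Gamma) (fun p =>
    if (val p).1 == v then V ^+ n.+1 else raag_gen (val p).1 ^ (V ^- (val p).2)).
  move=> [[u i] ui] [[w j] wj]; rewrite [adj _ _]/= /star_cover_adj /=.
  case: (eqVneq u v) => [->|uv]; case: (eqVneq w v) => [->|wv] /andP[uw ijst].
  - exact: commute_refl.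
  - apply: commute_sym; apply: commuteX; rewrite linkJ //.
    by apply: commute_sym; apply: raag_gen_commute.
  - rewrite adj_sym in uw; apply: commuteX; rewrite linkJ //.
    by apply: commute_sym; apply: raag_gen_commute.
  (* With equal indices both generators are conjugated by the same power of [V]. Otherwise one of
     them is in the link, is fixed by that conjugation, and can be given the index of the other. *)
  - have cuw k := commuteJ (V ^- k) (raag_gen_commute uw).
    case/or3P: ijst => [/eqP<- //||]; rewrite /star ?(negbTE uv) ?(negbTE wv) /=.
      by move=> vu; have := cuw j; rewrite /V !(linkJ _ vu).
    by move=> vw; have := cuw i; rewrite /V !(linkJ _ vw).
exists F; split=> [i|u i uv]; rewrite FE /= ?eqxx // (negbTE uv).
by rewrite /star (negbTE uv) /=; case: ifP => // vu; rewrite !linkJ.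
Qed.

Variable F : UMagmaMorphism.type (raag star_cover) (raag Gamma).
Hypothesis Fv : forall i, F (raag_gen (copy v i)) = V ^+ n.+1.
Hypothesis Fu :
  forall u i, u != v -> F (raag_gen (copy u i)) = raag_gen u ^ (V ^- i).

Section Injectivity.

(* The monodromy of the cover: crossing from the last copy back to the first
   contributes the generator [v] of the cover, which [F] maps to [v^(n+1)]. *)
Let k (u : Gamma) (i : 'I_n.+1) : raag star_cover :=
  if (u == v) && (i != ord_max) then 1 else raag_gen (copy u i).

Let kC u w i : u != v -> w != v -> adj u w -> commute (k u i) (k w i).
Proof.
rewrite /k => /negbTE-> /negbTE-> uw /=; apply: raag_gen_commute.
exact: adj_copy.
Qed.

Let kvC u i : adj v u -> k v i * k u (ordS i) = k u i * k v i.
Proof.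
move=> vu; have uv : u != v.
  by apply: contraTneq vu => ->; rewrite adj_irrefl.
rewrite /k eqxx (negbTE uv) /=.
have -> : copy u (ordS i) = copy u i by apply: val_inj; rewrite /= /star vu orbT.
case: ifP => _; first by rewrite mul1g mulg1.
exact: (raag_gen_commute (adj_copy_base _ _ vu)).
Qed.

Let skM := skewM kC kvC.

Let skew_pow g (l : 'I_n.+1) : skew v k (V ^+ l) (g, ord0) = (g, l).
Proof.
case: l => l; elim: l => [|l IH] lt_l /=.
  by rewrite (skew1 kC kvC); congr (_, _); apply: val_inj.
rewrite expgSr skM (IH (ltnW lt_l)) (skew_base kC kvC) /k eqxx ifT.
  by rewrite mulg1; congr (_, _); apply: val_inj; rewrite /= modn_small.
by rewrite -(inj_eq val_inj) /=; lia.
Qed.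

Let copy_base i j : copy v i = copy v j.
Proof. by apply: val_inj; rewrite /= /star eqxx. Qed.

(** From index [0], [V^i] leads to copy [i], where [u] contributes [copy u i], and [V^-i] leads
    back. For [v] itself, [n + 1] steps go once around the cycle and collect the generator at the
    last index. *)
Let skew_gen_image (p : star_cover) g :
  skew v k (F (raag_gen p)) (g, ord0) = (g * raag_gen p, ord0).
Proof.
rewrite -[p]copy_val; move: (val p).1 (val p).2 => u i.
case: (eqVneq u v) => [->|uv].
  rewrite Fv expgSr skM (skew_pow g ord_max) (skew_base kC kvC) /k !eqxx /=.
  rewrite (copy_base _ i); congr (_, _); apply: val_inj.
  by rewrite /= modnn.
rewrite Fu // conjgE invgK !skM skew_pow (skew_gen kC kvC) // /k (negbTE uv) /=.
by apply: (skewKE kC kvC); rewrite skew_pow.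
Qed.

(** The action of [F x] on [(1, ord0)] recovers [x]. *)
Lemma star_cover_inj : injective F.
Proof.
have skewE (x : raag star_cover) g :
    skew v k (F x) (g, ord0) = (g * x, ord0).
  elim/raag_ind: x g => [|[p b] x IH] g.
    by rewrite gmulf1 (skew1 kC kvC) mulg1.
  rewrite gmulfM skM gmulf_letter /letter_elt /=; case: b.
    rewrite (@skewKE _ _ _ _ _ kC kvC _ (g * (raag_gen p)^-1, ord0)).
      by rewrite IH mulgA.
    by rewrite skew_gen_image mulgVK.
  by rewrite skew_gen_image IH mulgA.
move=> x y xy; have := skewE x 1; rewrite xy skewE !mul1g.
by case.
Qed.

End Injectivity.

(** The index follows the exponent of [V]: letters [v] only shift it and disappear from [h], while
    any other letter lifts to its copy at the current index. The bounds keep the index within the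
    [n + 1] copies. *)
Lemma star_cover_lift w i : size w <= i -> i + size w < n.+1 ->
  exists (h : word star_cover) (j : 'I_n.+1),
    V ^+ i * word_elt w = F (word_elt h) * V ^+ j /\
    size h + count (fun l => l.1 == v) w = size w.
Proof.
elim: w i => [|[u b] w IH] i /= le_i lt_i.
  have lt_in : i < n.+1 by lia.
  exists [::], (Ordinal lt_in).
  by rewrite !word_elt_nil gmulf1 mulg1 mul1g.
rewrite word_elt_cons; case: (eqVneq u v) => [->|uv] /=.
  case: b; rewrite /letter_elt /=.
    have [||h [j [hE sz]]] := IH i.-1; [lia|lia|].
    exists h, j; split; last by rewrite addnCA sz.
    rewrite -hE mulgA; have {1}-> : i = i.-1.+1 by lia.
    by rewrite expgSr mulgK.
  have [||h [j [hE sz]]] := IH i.+1; [lia|lia|].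
  exists h, j; split; last by rewrite addnCA sz.
  by rewrite -hE mulgA -expgSr.
have [||h [j [hE sz]]] := IH i; [lia|lia|].
exists ((copy u (inord i), b) :: h), j; split; last by rewrite /= addSn sz.
rewrite word_elt_cons gmulfM gmulf_letter /= Fu // inordK; last by lia.
rewrite conjg_signed -mulgA -hE conjgE invgK /letter_elt /=.
by rewrite !mulgA mulgVK.
Qed.

End StarCover.

(** * Induced subgraphs *)

(** Killing the generators outside the image of [c] gives a left inverse; it respects the relations
    because [c] reflects adjacency. *)
Lemma raag_induced_embed (Lambda Gamma : graph) (c : Lambda -> Gamma) :
  injective c -> (forall a b, adj (c a) (c b) = adj a b) ->
  exists f : {multiplicative raag Lambda -> raag Gamma}, injective f.
Proof.
move=> c_inj cE.
have /choice[r rE] (u : Gamma) : exists o : option Lambda,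
    if o is Some a then c a = u else forall a, c a != u.
  case: (pselect (exists a, c a = u)) => [[a ca]|nc]; first by exists (Some a).
  by exists None => a; apply/eqP => ca; apply: nc; exists a.
have [|f fE] := @raag_lift Lambda (raag Gamma) (fun a => raag_gen (c a)).
  by move=> a b ab; apply: raag_gen_commute; rewrite cE.
have [|g gE] := @raag_lift Gamma (raag Lambda)
    (fun u => if r u is Some a then raag_gen a else 1).
  move=> u w; have := rE u; have := rE w.
  case: (r u) => [a|]; case: (r w) => [b|].
  - by move=> <- <-; rewrite cE; apply: raag_gen_commute.
  - by move=> *; apply: commute1.
  - by move=> *; apply/commute_sym/commute1.
  - by move=> *; apply: commute1.
have rc a : r (c a) = Some a.
  have := rE (c a); case: (r (c a)) => [b /c_inj->//|/(_ a)].
  by rewrite eqxx.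
exists f; apply: (can_inj (g := g)) => x.
elim/raag_ind: x => [|[a b] x IH]; first by rewrite !gmulf1.
rewrite !gmulfM IH gmulf_letter /= fE.
by case: b; rewrite /letter_elt /= ?gmulfV gE rc.
Qed.

(** * Induction on the total length of the conjugators *)

(** The inverse makes this [w u w^-1], so that [V^m] on the left can be absorbed by reading [w]. *)
Definition conj_gen (Gamma : graph) (u : Gamma) (w : word Gamma) : raag Gamma :=
  raag_gen u ^ (word_elt w)^-1.

(** [Gamma], [c] and [g] vary in the induction, since each step replaces [Gamma] by a star cover;
    [s] enumerates [Lambda] for the length sum. *)
Lemma raag_conj_embed N (Lambda Gamma : graph) (s : seq Lambda)
    (c : Lambda -> Gamma) (g : Lambda -> word Gamma) :
  (forall a, a \in s) -> \sum_(a <- s) size (g a) <= N ->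
  injective (fun a => conj_gen (c a) (g a)) ->
  (forall a b, a != b ->
    adj a b <-> commute (conj_gen (c a) (g a)) (conj_gen (c b) (g b))) ->
  exists f : {multiplicative raag Lambda -> raag Gamma}, injective f.
Proof.
elim: N Gamma c g => [|N IH] Gamma c g sT szN x_inj xcomm;
  pose x a := conj_gen (c a) (g a);
  have {}xcomm : forall a b, a != b -> adj a b <-> commute (x a) (x b) := xcomm.
  have xE a : x a = raag_gen (c a).
    have : size (g a) <= \sum_(b <- s) size (g b).
      by rewrite (big_rem a) ?sT //= leq_addr.
    rewrite /x /conj_gen; case: (g a) => [|l w] /=; last by lia.
    by rewrite word_elt_nil invg1 conjg1.
  have c_inj : injective c.
    by move=> a b ab; apply: x_inj; rewrite -!/(x _) !xE ab.
  apply: (raag_induced_embed c_inj) => a b.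
  have [->|ab] := eqVneq a b; first by rewrite !adj_irrefl.
  apply/idP/idP => [cab|/(xcomm _ _ ab)].
    by apply/(xcomm _ _ ab); rewrite !xE; apply: raag_gen_commute.
  by rewrite !xE; apply: raag_gen_commute_adj; rewrite (inj_eq c_inj).
case: (pselect (exists a, g a != [::])) => [[a0]|g0]; last first.
  apply: (IH Gamma c g) => //; rewrite big1_seq // => a _.
  by apply/eqP; rewrite size_eq0; apply: contra_notT g0 => ga; exists a.
case ga0: (g a0) => [//|[v e] w0] _.
(* There are [n + 1 = 2m + 1] copies: a word of length at most [m] read from index [m] never leaves
   them, and the exponent [n + 1] is odd. *)
pose m := \sum_(a <- s) size (g a); pose n := m.*2.
have g_le a : size (g a) <= m by rewrite /m (big_rem a) ?sT //= leq_addr.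
have [F [Fv Fu]] := star_cover_hom v n.
pose V := raag_gen v.
have F_inj : injective F := star_cover_inj Fv Fu.
have /choice[hj hjE] a : exists hj : word (star_cover v n) * 'I_n.+1,
    V ^+ m * word_elt (g a) = F (word_elt hj.1) * V ^+ hj.2 /\
    size hj.1 + count (fun l => l.1 == v) (g a) = size (g a).
  have [||h [j hjE]] := @star_cover_lift _ v n F Fu (g a) m.
  - exact: g_le.
  - by rewrite /n -addnn ltnS leq_add2l g_le.
  - by exists (h, j).
pose y a := conj_gen (copy v (c a) (hj a).2) (hj a).1.
pose p a := if c a == v then n.+1 else 1%N.
have p_odd a : odd (p a) by rewrite /p; case: ifP => //=; rewrite odd_double.
have p_gt0 a : 0 < p a by rewrite /p; case: ifP.
have Fy a : F (y a) = (x a ^ (V ^- m)) ^+ p a.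
  (* Since [V^m g = F(h) V^j], the remaining conjugation by [V^j] turns [c a] into the image of its
     [j]-th copy, or fixes it if it is [v]. *)
  have [hE _] := hjE a; rewrite gmulfJ gmulfV /x /conj_gen -conjgM -invgM hE invgM conjgM.
  rewrite /p; case: (eqVneq (c a) v) => [->|cv].
    rewrite Fv -!conjXg; congr (_ ^ _); symmetry; apply: conjg_id.
    by apply: commuteV; apply: commuteX2.
  by rewrite Fu // expg1.
have powC a b : commute (x a ^+ p a) (x b ^+ p b) -> commute (x a) (x b).
  exact: commute_conj_pow2.
have y_inj : injective y.
  move=> a b /(congr1 F); rewrite !Fy -!conjXg => /conjg_inj; rewrite !conjXg => xab.
  (* Odd exponents force equal generators, hence equal exponents, and then roots are unique. *)
  have cab : c a = c b := conj_odd_pow_gen (p_odd a) (p_odd b) xab.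
  have pab : p a = p b by rewrite /p cab.
  apply: x_inj; move: xab; rewrite /conj_gen pab cab; exact: conj_pow_inj.
have y_comm a b : a != b -> adj a b <-> commute (y a) (y b).
  move=> ab; split=> [/(xcomm _ _ ab) cab|cab].
    have FM : {morph F : z t / z * t} := gmulfM.
    apply: F_inj; rewrite (FM (y a)) (FM (y b)) !Fy.
    exact: (commuteX2 (p a) (p b) (commuteJ (V ^- m) cab)).
  apply/(xcomm _ _ ab)/powC; move: (gmulf_commute F cab); rewrite !Fy -!conjXg.
  by move=> /(commuteJ (V ^+ m)); rewrite !conjgKV.
have [f f_inj] : exists f : {multiplicative raag Lambda -> raag (star_cover v n)},
    injective f.
  apply: (IH _ (fun a => copy v (c a) (hj a).2) (fun a => (hj a).1)) => //.
  rewrite -ltnS; apply: leq_trans szN.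
  have h_le a : size (hj a).1 <= size (g a) by have [_ <-] := hjE a; exact: leq_addr.
  (* The sum drops strictly at [a0], whose word begins with a letter [v] that is deleted. *)
  rewrite (big_rem a0) ?sT //= [leqRHS](big_rem a0) ?sT //= -addSn.
  apply: leq_add; last by apply: leq_sum => a _; apply: h_le.
  by have [_ <-] := hjE a0; rewrite ga0 /= eqxx addnS ltnS leq_addr.
by exists (F \o f); apply: inj_comp.
Qed.

(** * Application to the extension graph *)

Theorem theorem2 (Lambda Gamma : graph)
    (finLambda : finite_graph Lambda) (finGamma : finite_graph Gamma)
    (A : {pred extension_graph Gamma})
    (isoA : graph_iso Lambda (induced_subgraph A)) :
  exists f : {multiplicative raag Lambda -> raag Gamma}, injective f.
Proof.
have /finite_seqP[s sE] := finLambda.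
case: isoA => i [j ij _] iE.
pose x a : raag Gamma := val (val (i a)).
have x_inj : injective x by move=> a b /val_inj/val_inj/(can_inj ij).
have /choice[cg cgE] a : exists cg : Gamma * word Gamma, x a = conj_gen cg.1 cg.2.
  (* Here [g] conjugates on the right, so the word for [conj_gen] represents [g^-1]. *)
  have /asboolP[u [g e]] := valP (val (i a)); exists (u, repr g^-1).
  by apply: etrans e _; rewrite /conj_gen word_elt_repr invgK.
apply: (@raag_conj_embed _ Lambda Gamma s (fun a => (cg a).1) (fun a => (cg a).2)).
- by move=> a; have : [set: Lambda]%classic a by []; rewrite sE.
- exact: leqnn.
- by move=> a b; rewrite -!cgE; apply: x_inj.
- move=> a b ab; rewrite -!cgE -iE.
  (* Distinctness reduces adjacency in the extension graph to commutation. *)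
  have : i a != i b by rewrite (inj_eq (can_inj ij)).
  rewrite -[adj (i a) _]/((val (i a) != val (i b)) && (x a * x b == x b * x a)).
  by rewrite (inj_eq val_inj) => ->; split=> [/eqP|/eqP].
Qed.
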